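(* Let $T$ be a numerical semigroup and let $S:=\frac{T}{2}$, $M:=M(S)$, $K:=K(S)$. Then $T$ is almost symmetric with odd type if and only if there exist a relative ideal $E$ of $S$ and an odd integer $b\in S$ such that, setting $e:=f(E)-f(S)$ and $\widetilde E:=E-e=\{y-e \mid y\in E\}$: (1) $T=S\bowtie^b E$; (2) $f(T)=2f(E)+b$; (3) $K-(M-M)\subseteq\widetilde E\subseteq K$; (4) $K-\widetilde E$ is a numerical semigroup; (5) $b+e+E+K\subseteq M$.
   Context: $\mathbb{N}$ denotes the non-negative integers. A numerical semigroup $S$ is a submonoid of $\mathbb{N}$ with $\mathbb{N}\setminus S$ finite; $f(S)=\max(\mathbb{Z}\setminus S)$ is its Frobenius number (so $f(\mathbb{N})=-1$). $\mathrm{PF}(S)=\{x\in\mathbb{Z}\setminus S \mid x+s\in S \text{ for any } s\in S\setminus\{0\}\}$, and the type of $S$ is $|\mathrm{PF}(S)|$. $\mathrm{L}(S)=\{x\in\mathbb{Z} \mid x\notin S,\ f(S)-x\notin S\}$; $S$ is almost symmetric if $\mathrm{L}(S)\subseteq \mathrm{PF}(S)$. $\frac{T}{2}=\{s\in\mathbb{N}\mid 2s\in T\}$. A relative ideal of $S$ is a nonempty $E\subseteq\mathbb{Z}$ with $E+S\subseteq E$ and $x+E\subseteq S$ for some $x\in S$; $f(E)=\max(\mathbb{Z}\setminus E)$. $M(S)=S\setminus\{0\}$ and $K(S)=\{x\in\mathbb{Z}\mid f(S)-x\notin S\}$ are relative ideals of $S$. For relative ideals $E,F$ of $S$, $E-F=\{x\in\mathbb{Z}\mid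 x+y\in E\text{ for any }y\in F\}$; $E+F$ is the set of sums, and for an integer $z$, $E\pm z$ denotes the translate. $S\bowtie^b E=2\cdot S\cup(2\cdot E+b)$, where $2\cdot X=\{2x\mid x\in X\}$. *)

(* Defs.v *)
From HB Require Import structures.
From mathcomp Require Import all_boot all_order all_algebra.
From mathcomp Require Import finmap.
From mathcomp Require Import mathcomp_extra boolp classical_sets functions cardinality.

Set Implicit Arguments.
Unset Strict Implicit.
Unset Printing Implicit Defensive.

Import Order.TTheory GRing.Theory Num.Theory.

Local Open Scope classical_set_scope.
Local Open Scope ring_scope.

(* Numerical semigroups and relative ideals all live in [set int], so that
   f(S), PF(S), L(S), K(S) and E - F can range over the whole of Z. *)

Definition nonneg_int : set int := [set x | 0 <= x].

Definition numerical_semigroup (S : set int) : Prop :=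
  [/\ S `<=` nonneg_int,
      S 0,
      (forall x y, S x -> S y -> S (x + y)) &
      finite_set (nonneg_int `\` S)].

(* max (Z \ X), with default value 0 if the maximum does not exist; it does
   exist for numerical semigroups and for their relative ideals. *)
Definition frobenius (X : set int) : int :=
  xget 0 [set m | ~ X m /\ forall x, ~ X x -> x <= m].

Definition pseudo_frobenius (S : set int) : set int :=
  [set x | ~ S x /\ forall s, S s -> s <> 0 -> S (x + s)].

(* PF(S) is finite for a numerical semigroup S, so that [fset_set], which
   sends infinite sets to fset0, has the elements of PF(S) here. *)
Definition semigroup_type (S : set int) : nat :=
  #|` fset_set (pseudo_frobenius S)|.

Definition Lset (S : set int) : set int :=
  [set x | ~ S x /\ ~ S (frobenius S - x)].

Definition almost_symmetric (S : set int) : Prop :=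
  Lset S `<=` pseudo_frobenius S.

Definition half_semigroup (T : set int) : set int := [set s | 0 <= s /\ T (2 * s)].

Definition relative_ideal (S E : set int) : Prop :=
  [/\ E !=set0,
      (forall y s, E y -> S s -> E (y + s)) &
      exists2 x, S x & forall y, E y -> S (x + y)].

Definition maximal_ideal (S : set int) : set int := S `\ 0.

Definition canonical_ideal (S : set int) : set int :=
  [set x | ~ S (frobenius S - x)].

(* E - F for relative ideals (not the set of differences) *)
Definition ideal_diff (E F : set int) : set int :=
  [set x | forall y, F y -> E (x + y)].

Definition set_add (E F : set int) : set int :=
  [set x + y | x in E & y in F].

Definition translate (E : set int) (z : int) : set int :=
  [set y + z | y in E].

Definition double_set (X : set int) : set int := [set 2 * x | x in X].

(* S ⋈^b E *)
Definition duplication (S : set int) (b : int) (E : set int) : set int :=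
  double_set S `|` translate (double_set E) b.

(* Main.v *)
(* For almost symmetric T, PF(T) is the disjoint union of {f(T)} and L(T), and
   x |-> f(T) - x is an involution of L(T) whose only possible fixed point is
   f(T)/2; hence the type is odd iff f(T) is odd.  For any large odd b, let E
   consist of the x with 2x + b in T, so that f(T) is odd iff
   f(T) = 2f(E) + b.  In that case the involution exchanges the even and the
   odd elements of L(T), which are the 2y with y in (K - E~) \ S and the
   2(z + e) + b with z in K \ E~.  Being pseudo-Frobenius then splits into
   y + M <= M and z + M <= E~, both equivalent to (3) by duality with respect
   to K; y + E~ <= E~, equivalent to (4); and z + e + b + E <= S, which is (5)
   since E + E + b <= S always holds. *)
Require Import Defs.
From mathcomp Require Import all_boot all_order all_algebra.
From mathcomp Require Import boolp classical_sets.
From mathcomp Require Import finmap cardinality zify.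

Import Order.TTheory GRing.Theory Num.Theory.

Local Open Scope classical_set_scope.
Local Open Scope ring_scope.

(** * Existence of Frobenius numbers *)

Lemma frobenius_eq (X : set int) (m : int) :
  ~ X m -> (forall x, ~ X x -> x <= m) -> frobenius X = m.
Proof.
move=> Xm maxm; rewrite /frobenius; case: xgetP => [n _ [Xn maxn]|/(_ m)[]//].
by apply/eqP; rewrite eq_le maxm // maxn.
Qed.

(** The least natural [n] with [B - n] outside [X] locates the maximum; [a] shows that such an [n]
    exists. *)
Lemma frobeniusP (X : set int) (a B : int) :
  ~ X a -> (forall x, ~ X x -> x <= B) ->
  ~ X (frobenius X) /\ forall x, ~ X x -> x <= frobenius X.
Proof.
move=> Xa leB.
have exn : exists n : nat, `[< ~ X (B - n%:Z) >].
  exists `|B - a|%N; apply/asboolP; have := leB _ Xa => leaB.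
  by have -> : B - `|B - a|%N%:Z = a by lia.
case: (ex_minnP exn) => n /asboolP Xn minn.
have maxn x : ~ X x -> x <= B - n%:Z.
  move=> Xx; have lexB := leB _ Xx.
  have : (n <= `|B - x|)%N.
    apply/minn/asboolP.
    by have -> : B - `|B - x|%N%:Z = x by lia.
  by lia.
by rewrite (frobenius_eq _ _ Xn maxn).
Qed.

Lemma numerical_semigroup_frobeniusP (S : set int) :
  numerical_semigroup S ->
  ~ S (frobenius S) /\ forall x, ~ S x -> x <= frobenius S.
Proof.
move=> [S_ge0 _ _ finS].
have [B leB] : exists B : int, forall x, ~ S x -> x <= B.
  case/finite_seqP: finS => s s_eq.
  (* The sum of the absolute values of the nonnegative gaps bounds each of them; negative integers
     lie below it. *)
  exists (\sum_(y <- s) `|y|) => x Sx.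
  have [x_ge0|x_lt0] := leP 0 x; last first.
    by apply: le_trans (ltW x_lt0) _; apply: sumr_ge0.
  have : [set` s] x by rewrite -s_eq.
  move=> /= xs; rewrite (big_rem x) //=; apply: (le_trans (ler_norm x)).
  by rewrite lerDl; apply: sumr_ge0.
apply: (@frobeniusP _ (-1) B) => // /S_ge0; rewrite /nonneg_int /=; lia.
Qed.

(** * Parity of the type *)

(* The involution [x |-> f - x] has [f / 2] as its only possible fixed point. *)
Lemma odd_size_involution (f : int) (s : seq int) :
  uniq s -> (forall x, x \in s -> f - x \in s) ->
  odd (size s) = has (fun x => 2 * x == f) s.
Proof.
move=> us fs.
have s_perm : perm_eq s [seq f - x | x <- s].
  apply: uniq_perm => //.
    by rewrite map_inj_uniq // => x y; lia.
  move=> x; apply/idP/mapP => [xs|[y ys ->]]; last exact: fs.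
  by exists (f - x); [exact: fs|lia].
pose lo := fun x : int => 2 * x < f.
pose hi := fun x : int => f < 2 * x.
pose mid := fun x : int => 2 * x == f.
(* Reflection swaps the elements on either side of [f / 2], so only midpoints affect the parity. *)
have hi_lo : count hi s = count lo s.
  rewrite (permP s_perm hi) count_map; apply: eq_count => x /=.
  by rewrite /hi /lo; lia.
have size_s : size s = (count lo s + count hi s + count mid s)%N.
  by elim: s {us fs s_perm hi_lo} => //= x s ->; rewrite /lo /hi /mid; lia.
have mid_le1 : (count mid s <= 1)%N.
  case: (boolP (has mid s)) => [/hasP[m ms /eqP midm]|].
    rewrite (@eq_count _ mid (pred1 m)) ?count_uniq_mem ?leq_b1 // => x /=.
    by rewrite /mid; lia.
  by rewrite has_count; lia.
rewrite size_s hi_lo has_count -/mid; case: (count mid s) mid_le1 => [|[|//]] _; lia.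
Qed.

Lemma almost_symmetric_odd_type (T : set int) :
  numerical_semigroup T -> almost_symmetric T ->
  odd (semigroup_type T) = ~~ (2 %| frobenius T)%Z.
Proof.
move=> hT asT; have [Tf maxf] := numerical_semigroup_frobeniusP _ hT.
case: hT => T_ge0 T0 TD finT.
set f := frobenius T in Tf maxf *.
have PFf : pseudo_frobenius T f.
  split=> // s Ts s0; apply: contrapT => /maxf.
  have := T_ge0 _ Ts; rewrite /nonneg_int /=; lia.
have PF_sym x : pseudo_frobenius T x -> x <> f -> ~ T (f - x).
  move=> [Tx xT] xf Tfx; apply: Tf.
  have -> : f = x + (f - x) by lia.
  by apply: xT => //; lia.
have L_PF x : ~ T x -> ~ T (f - x) -> pseudo_frobenius T x.
  by move=> Tx Tfx; apply: asT.
have finPF : finite_set (pseudo_frobenius T).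
  have : finite_set ((nonneg_int `\` T) `|` [set f]).
    by rewrite finite_setU; split.
  apply: sub_finite_set => x PFx.
  have [->|xf] := pselect (x = f); first by right.
  left; split; last by case: PFx.
  have := maxf _ (PF_sym _ PFx xf); rewrite /nonneg_int /=; lia.
rewrite /semigroup_type; set s := enum_fset (fset_set (pseudo_frobenius T)).
have us : uniq s by exact: fset_uniq.
have sP x : x \in s <-> pseudo_frobenius T x.
  have -> : (x \in s) = (x \in fset_set (pseudo_frobenius T)) by [].
  by rewrite in_fset_set //; split=> [/set_mem|PFx]; [|apply: mem_set].
have -> : #|` fset_set (pseudo_frobenius T)|%fset = (size (rem f s)).+1.
  have fs : f \in s by apply/sP.
  have s_gt0 : (0 < size s)%N by case: (s) fs.
  by rewrite size_rem // prednK.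
rewrite /= (@odd_size_involution f) ?rem_uniq //; last first.
  move=> x; rewrite !mem_rem_uniq // !inE => /andP[/eqP xf /sP PFx].
  apply/andP; split.
    apply/eqP => fx; case: PFx => Tx _; apply: Tx.
    by have -> : x = 0 by lia.
  apply/sP; apply: L_PF; first exact: PF_sym.
  have -> : f - (f - x) = x by lia.
  by case: PFx.
congr (~~ _); apply/hasP/idP => [[x _ /eqP <-]|]; first by lia.
(* For even [f], the half [h] is a gap since [h + h = f] is one; being its own reflection, it lies
   in L(T). *)
move=> /dvdzP[h fh]; exists h; last by apply/eqP; lia.
have Th : ~ T h.
  move=> Th; apply: Tf; have -> : f = h + h by lia.
  exact: TD.
rewrite mem_rem_uniq // !inE; apply/andP; split.
  apply/eqP => hf; apply: Tf; have -> : f = 0 by lia.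
  exact: T0.
apply/sP; apply: L_PF => //; by have -> : f - h = h by lia.
Qed.

(** * The duplication, and duality with respect to K *)

Lemma translateE (X : set int) (z x : int) : translate X z x <-> X (x - z).
Proof.
split=> [[y Xy <-]|Xx]; first by rewrite addrK.
by exists (x - z) => //; rewrite subrK.
Qed.

Section Duplication.
Variables (T S E : set int) (b : int).
Hypothesis hT : numerical_semigroup T.
Hypothesis S_def : S = half_semigroup T.
(** With [S_def], the elementwise form of (1): [b] being odd, [S] gives the even elements and [E]
    the odd ones. *)
Hypothesis TE : forall x, T (2 * x + b) <-> E x.
Hypothesis b_odd : ~~ (2 %| b)%Z.
Let e := frobenius E - frobenius S.
Let E' := translate E (- e).
Let K := canonical_ideal S.
Let M := maximal_ideal S.
Hypothesis fT : frobenius T = 2 * frobenius E + b.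

Let T_ge0 x : T x -> 0 <= x. Proof. by case: hT => + _ _ _; apply. Qed.
Let T0 : T 0. Proof. by case: hT. Qed.
Let TD x y : T x -> T y -> T (x + y). Proof. by case: hT => _ _ + _; apply. Qed.

Let TS x : T (2 * x) <-> S x.
Proof.
by rewrite S_def; split=> [Tx|[]//]; split=> //; have := T_ge0 _ Tx; lia.
Qed.

Let S_ge0 x : S x -> 0 <= x. Proof. by rewrite S_def => -[]. Qed.
Let S0 : S 0. Proof. by apply/TS; rewrite mulr0. Qed.
Let SD x y : S x -> S y -> S (x + y).
Proof. by move=> /TS Sx /TS Sy; apply/TS; rewrite mulrDr; apply: TD. Qed.

Let fTP := numerical_semigroup_frobeniusP _ hT.

Let fSP : ~ S (frobenius S) /\ forall x, ~ S x -> x <= frobenius S.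
Proof.
apply: (@frobeniusP _ (-1) `|frobenius T|) => [/S_ge0//|x /TS Tx].
have := fTP.2 _ Tx; lia.
Qed.

(** That is, [b + 2e > 0], strict by parity; it keeps 0 out of the sums in (5). *)
Let fS_lt : 2 * frobenius S < 2 * frobenius E + b.
Proof. have /fTP.2 : ~ T (2 * frobenius S) by move=> /TS /fSP.1. by lia. Qed.

Let E'E x : E' x <-> E (x + e).
Proof. by rewrite /E' translateE opprK. Qed.

Let E'S x y : E' x -> S y -> E' (x + y).
Proof.
rewrite !E'E => /TE Tx /TS Ty; apply/TE.
by (have -> : 2 * (x + y + e) + b = 2 * (x + e) + b + 2 * y by lia); apply: TD.
Qed.

(** The shift by [e] gives [E'] the Frobenius number of [S]. *)
Let E'f : ~ E' (frobenius S).
Proof. 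
rewrite E'E => /TE; have -> : 2 * (frobenius S + e) + b = frobenius T.
  by rewrite fT /e; lia.
exact: fTP.1.
Qed.

Let E'_max x : ~ E' x -> x <= frobenius S.
Proof.
rewrite E'E => nE; have /fTP.2 : ~ T (2 * (x + e) + b) by rewrite TE.
by rewrite fT /e; lia.
Qed.

Let E'K : E' `<=` K.
Proof.
move=> x E'x Sx; apply: E'f.
by (have -> : frobenius S = x + (frobenius S - x) by lia); apply: E'S.
Qed.

(** If [frobenius S - y] were in [E'], then [y] would send it to [frobenius S], which is outside [K]
    because of [S0]. *)
Let KE'P y : ideal_diff K E' y <-> ~ E' (frobenius S - y).
Proof.
split=> [yK E'y|E'y x E'x Sx].
  by apply: (yK _ E'y); have -> : frobenius S - (y + (frobenius S - y)) = 0 by lia.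
apply: E'y; have -> : frobenius S - y = x + (frobenius S - (y + x)) by lia.
exact: E'S.
Qed.

Let S_KE' y : S y -> ideal_diff K E' y.
Proof.
move=> Sy; apply/KE'P => E'y; apply: E'f.
by (have -> : frobenius S = (frobenius S - y) + y by lia); apply: E'S.
Qed.

Let KE'_ge0 y : ideal_diff K E' y -> 0 <= y.
Proof. by move=> /KE'P/E'_max; lia. Qed.

(** Additive closure is dual to acting on [E']: the reflection of [y + x], plus [y], is the
    reflection of [x]. *)
Let KE'_semigroupP :
  numerical_semigroup (ideal_diff K E') <->
  (forall y x, ideal_diff K E' y -> E' x -> E' (y + x)).
Proof.
split=> [[_ _ KD _] y x Ky E'x|stab].
  apply: contrapT => E'yx.
  have Kz : ideal_diff K E' (frobenius S - (y + x)).
    apply/KE'P.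
    by have -> : frobenius S - (frobenius S - (y + x)) = y + x by lia.
  have /KE'P := KD _ _ Kz Ky; apply.
  by have -> : frobenius S - (frobenius S - (y + x) + y) = x by lia.
split=> //.
- exact: S_KE'.
- move=> x y Kx Ky; apply/KE'P => E'xy; move/KE'P: Ky; apply.
  have -> : frobenius S - y = x + (frobenius S - (x + y)) by lia.
  exact: stab.
- have : finite_set [set x : int | x \in [seq n%:Z | n <- iota 0 `|frobenius S|.+1]].
    by apply/finite_seqP; eexists.
  apply: sub_finite_set => x [x_ge0 Kx]; rewrite /nonneg_int /= in x_ge0.
  have lex : x <= frobenius S.
    by apply: fSP.2 => /S_KE'.
  by apply/mapP; exists `|x|%N; rewrite ?mem_iota; lia.
Qed.

Let K_diffP :
  ideal_diff K (ideal_diff M M) `<=` E' <->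
  ideal_diff K E' `<=` ideal_diff M M.
Proof.
split=> [sub y /KE'P Ky|sub z zK].
  (* This yields [w] in M - M with [y - w] in [S], so [y] is in S + (M - M), which carries [M] into
     itself. *)
  have : ~ ideal_diff K (ideal_diff M M) (frobenius S - y) by move=> /sub.
  move=> /existsNP[w /not_implyP[Mw /contrapT]].
  have -> : frobenius S - (frobenius S - y + w) = y - w by lia.
  move=> Syw m Mm; have [Swm wm0] := Mw _ Mm.
  have -> : y + m = (y - w) + (w + m) by lia.
  split; first exact: SD.
  have := S_ge0 _ Syw; have := S_ge0 _ Swm.
  by move=> /= *; move: wm0 => /= wm0; lia.
apply: contrapT => E'z.
have /sub Mz : ideal_diff K E' (frobenius S - z).
  by apply/KE'P; have -> : frobenius S - (frobenius S - z) = z by lia.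
apply: (zK _ Mz).
by have -> : frobenius S - (z + (frobenius S - z)) = 0 by lia.
Qed.

Lemma almost_symmetric_duplication :
  almost_symmetric T <->
  [/\ ideal_diff K (ideal_diff M M) `<=` E' /\ E' `<=` K,
      numerical_semigroup (ideal_diff K E') &
      translate (set_add E K) (b + e) `<=` M].
Proof.
split=> [asT|].
  (* The reflection of [2 * y] is the odd number attached to [frobenius S - y], which is outside
     [E']; so [2 * y] is in L(T). *)
  have even_gap y : ideal_diff K E' y -> ~ S y -> pseudo_frobenius T (2 * y).
    move=> /KE'P Ky Sy; apply: asT; split; first by rewrite TS.
    have -> : frobenius T - 2 * y = 2 * (frobenius S - y + e) + b.
      by rewrite fT /e; lia.
    by rewrite TE -E'E.
  split.
  - split=> //; apply/K_diffP => y Ky m [Sm m0].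
    have m_gt0 : 0 < m by have := S_ge0 _ Sm; move: m0 => /= m0; lia.
    have y_ge0 := KE'_ge0 _ Ky.
    split; last by move=> /=; lia.
    have [Sy|Sy] := pselect (S y); first exact: SD.
    have [_ PFy] := even_gap _ Ky Sy.
    by apply/TS; rewrite mulrDr; apply: PFy; [apply/TS|lia].
  - apply/KE'_semigroupP => y x Ky E'x.
    have [Sy|Sy] := pselect (S y); first by rewrite addrC; apply: E'S.
    have [_ PFy] := even_gap _ Ky Sy.
    apply/E'E/TE; move/E'E/TE: E'x => Tx.
    have -> : 2 * (y + x + e) + b = 2 * y + (2 * (x + e) + b) by lia.
    by apply: PFy => //; lia.
  - move=> _ [_ [x Ex [k Kk <-]] <-].
    have Tx : T (2 * x + b) by apply/TE.
    have k_ge0 : 0 <= k by have := fSP.2 _ Kk; lia.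
    (* Twice the sum is [(2x + b) + (b + 2e) + 2k], whose middle term is positive by [fS_lt]. *)
    split; last first.
      by move=> /=; have := T_ge0 _ Tx; rewrite /e; lia.
    apply/TS; have -> : 2 * (x + k + (b + e)) = 2 * (k + e) + b + (2 * x + b) by lia.
    have [/E'E/TE Tk|E'k] := pselect (E' k); first exact: TD.
    have [_ PFk] : pseudo_frobenius T (2 * (k + e) + b).
      apply: asT; split; first by rewrite TE -E'E.
      have -> : frobenius T - (2 * (k + e) + b) = 2 * (frobenius S - k).
        by rewrite fT /e; lia.
      by rewrite TS.
    by apply: PFk => //; lia.
case=> -[/K_diffP sub _] /KE'_semigroupP stab EK x [Tx Tfx].
have even_or_odd t : (exists y, t = 2 * y) \/ (exists y, t = 2 * (y + e) + b).
  have [/dvdzP[y ->]|nt] := boolP (2 %| t)%Z; first by left; exists y; lia.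
  right; have /dvdzP[y ty] : (2 %| t - b)%Z by lia.
  by exists (y - e); lia.
split=> // t Tt t0.
(* Four parity cases: for even [x], (3) handles even [t] and (4) odd [t]; for odd [x], (3) by
   duality and (5). *)
have [[y xy]|[y xy]] := even_or_odd x; subst x.
  have Ky : ideal_diff K E' y.
    apply/KE'P; rewrite E'E => /TE; apply: contra_not Tfx.
    by congr (T _); rewrite fT /e; lia.
  have [[z tz]|[z tz]] := even_or_odd t; subst t.
    have [|+ _] := sub _ Ky z; first by split; [apply/TS|move=> /= z0; lia].
    by rewrite -mulrDr => Syz; apply/TS.
  have -> : 2 * y + (2 * (z + e) + b) = 2 * (y + z + e) + b by lia.
  by apply/TE/E'E/stab => //; apply/E'E/TE.
have Ky : K y.
  move=> /TS; apply: contra_not Tfx.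
  by congr (T _); rewrite fT /e; lia.
have [[z tz]|[z tz]] := even_or_odd t; subst t.
  have -> : 2 * (y + e) + b + 2 * z = 2 * (y + z + e) + b by lia.
  (* The reflection of [y + z] would then be in M - M, and adding [z] would put [frobenius S - y] in
     [S]. *)
  apply/TE/E'E; apply: contrapT => E'yz; apply: Ky.
  have [||+ _] := sub (frobenius S - (y + z)) _ z.
  - apply/KE'P.
    by have -> : frobenius S - (frobenius S - (y + z)) = y + z by lia.
  - by split; [apply/TS|move=> /= z0; lia].
  by have -> : frobenius S - (y + z) + z = frobenius S - y by lia.
have -> : 2 * (y + e) + b + (2 * (z + e) + b) = 2 * (z + e + y + (b + e)) by lia.
apply/TS; suff [] : M (z + e + y + (b + e)) by [].
apply: EK; exists (z + e + y) => //; exists (z + e); first exact/TE.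
by exists y.
Qed.

End Duplication.

(** * Choice of E and b, and the equivalence *)

Theorem theorem3p7 (T : set int) (hT : numerical_semigroup T) :
  let S := half_semigroup T in
  let M := maximal_ideal S in
  let K := canonical_ideal S in
  (almost_symmetric T /\ odd (semigroup_type T)) <->
  (exists (E : set int) (b : int),
     relative_ideal S E /\ S b /\ ~~ (2 %| b)%Z /\
     let e := frobenius E - frobenius S in
     let E' := translate E (- e) in
     [/\ T = duplication S b E,
         frobenius T = 2 * frobenius E + b,
         ideal_diff K (ideal_diff M M) `<=` E' /\ E' `<=` K,
         numerical_semigroup (ideal_diff K E') &
         translate (set_add E K) (b + e) `<=` M]).
Proof.
move=> S M K; split=> [[asT]|[E [b [_ [_ [b_odd [defT fT c3 c4 c5]]]]]]].
  rewrite (almost_symmetric_odd_type _ hT asT) => f_odd.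
  have [Tf maxf] := numerical_semigroup_frobeniusP _ hT.
  have Tbig x : frobenius T < x -> T x.
    by move=> ltx; apply: contrapT => /maxf; lia.
  case: (hT) => T_ge0 T0 TD _; rewrite /nonneg_int in T_ge0.
  (* An odd number above [frobenius T], so [b] and [2 * b] are in [T]; thus [b] is in [S] and can
     shift [E] into [S]. *)
  pose b : int := 2 * `|frobenius T| + 1.
  pose E : set int := [set x | T (2 * x + b)].
  have b_odd : ~~ (2 %| b)%Z by rewrite /b; lia.
  have fT : frobenius T = 2 * frobenius E + b.
    (* Odd type enters here: it makes this difference even, and half of it is the largest integer
       outside [E]. *)
    have /dvdzP[F hF] : (2 %| frobenius T - b)%Z by lia.
    rewrite (@frobenius_eq E F); first by lia.
      by rewrite /E /=; have -> : 2 * F + b = frobenius T by lia.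
    by move=> x /maxf; lia.
  have TE x : T (2 * x + b) <-> E x by [].
  have [c3 c4 c5] := (almost_symmetric_duplication _ _ _ _ hT erefl TE b_odd fT).1 asT.
  have Sb : S b by split; [|apply: Tbig]; rewrite /b; lia.
  exists E, b; split; last split=> //; last split=> //; last split=> //.
    split.
    - by exists `|frobenius T|; apply: Tbig; rewrite /b; lia.
    - move=> y s Ey [_ Ts]; rewrite /E /=.
      by (have -> : 2 * (y + s) + b = 2 * y + b + 2 * s by lia); apply: TD.
    - exists b => // y Ey.
      have Tby : T (2 * (b + y)).
        have -> : 2 * (b + y) = 2 * y + b + b by lia.
        by apply: TD => //; apply: Tbig; rewrite /b; lia.
      by split=> //; have := T_ge0 _ Tby => /=; lia.
  apply/seteqP; split=> x.
    move=> Tx; have [/dvdzP[y xy]|x_odd] := boolP (2 %| x)%Z.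
      left; exists y; last by lia.
      have xy2 : x = 2 * y by lia.
      by split; [have := T_ge0 _ Tx => /=; lia|rewrite -xy2].
    right; have /dvdzP[y xy] : (2 %| x - b)%Z by lia.
    apply/translateE; exists y; last by lia.
    by rewrite /E /=; have -> : 2 * y + b = x by lia.
  case=> [[y [_ Ty] <-]//|/translateE[y Ey xy]].
  by have -> : x = 2 * y + b by lia.
(* As [b] is odd, an odd element of the duplication can only come from [E]. *)
have TE x : T (2 * x + b) <-> E x.
  split=> [|Ex]; last first.
    by rewrite defT; right; apply/translateE; exists x => //; lia.
  rewrite defT => -[[y _ xy]|/translateE[y Ey xy]]; first by lia.
  by have -> : x = y by lia.
have asT : almost_symmetric T by apply/(almost_symmetric_duplication _ _ _ _ hT erefl TE b_odd fT).
by split=> //; rewrite almost_symmetric_odd_type // fT; lia.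
Qed.
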